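(* For each $(x,y)\in\mathcal{Z}$ let $C_{xy}:[0,\infty)\to[0,\infty]$ be convex. Suppose that for every $\boldsymbol{m}\in\mathcal{P}(\mathcal{X})$ and every $\boldsymbol{\xi}\in\mathbb{R}^{|\mathcal{Z}|}$ $$\inf_{\boldsymbol{q}\in[0,\infty)^{|\mathcal{Z}|}}\ \sup_{\boldsymbol{u}\in(0,\infty)^{|\mathcal{Z}|}}\Big\{\sum_{(x,y)\in\mathcal{Z}}m_xL_{xy}(u_{xy},q_{xy})\Big\}=\sup_{\boldsymbol{u}\in(0,\infty)^{|\mathcal{Z}|}}\ \inf_{\boldsymbol{q}\in[0,\infty)^{|\mathcal{Z}|}}\Big\{\sum_{(x,y)\in\mathcal{Z}}m_xL_{xy}(u_{xy},q_{xy})\Big\},$$ where $$L_{xy}(u,q)=q\,\xi_{xy}+u\,\ell\Big(\frac qu\Big)-\gamma_{xy}C_{xy}\Big(\frac u{\gamma_{xy}}\Big),$$ and suppose that for each $(x,y)\in\mathcal{Z}$, $C_{xy}$ is (finite and) twice differentiable on some non-empty open interval $(u_{1,xy},u_{2,xy})\subset(0,\infty)$. Then for each $(x,y)\in\mathcal{Z}$ the function $u\mapsto uC_{xy}'(u)-u$ is increasing (in the weak sense) on $(u_{1,xy},u_{2,xy})$.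
   Context: $\mathcal{X}=\{e_1,\dots,e_d\}$ is the set of standard unit vectors of $\mathbb{R}^d$; $\boldsymbol{\gamma}=\{\gamma_{xy}\}$ are the jump rates of an ergodic Markov jump process on $\mathcal{X}$; $\mathcal{Z}=\{(x,y)\in\mathcal{X}\times\mathcal{X}:\gamma_{xy}>0\}$; $\mathcal{P}(\mathcal{X})$ is the simplex of probability vectors $\boldsymbol{m}=(m_x)_{x\in\mathcal{X}}$. $\ell(q)=q\log q-q+1$ for $q\ge0$, with $\ell(0)=1$. Convention: $0\cdot(\pm\infty)=0$. *)

(* Defs.v *)
From HB Require Import structures.
From mathcomp Require Import all_boot all_order all_algebra.
From mathcomp Require Import all_classical all_reals all_analysis.
Set Implicit Arguments.
Unset Strict Implicit.
Unset Printing Implicit Defensive.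
Import Order.TTheory GRing.Theory Num.Theory.
Import numFieldNormedType.Exports.
Local Open Scope classical_set_scope.
Local Open Scope ring_scope.

(* The state e_i is represented by its index i : 'I_d.  The diagonal of gamma
   is unconstrained, so that the conventions gamma x x = 0 and
   gamma x x = - (exit rate of x) are both covered.  A finite-state jump
   process is ergodic when any state can be reached from any other one through
   jumps of positive rate. *)
Definition ergodic_rates (R : realType) (d : nat)
    (gamma : 'I_d -> 'I_d -> R) : Prop :=
  (forall x y, x != y -> 0 <= gamma x y) /\
  (forall x y, connect [rel a b | 0 < gamma a b] x y).

(* The set Z; a vector of R^|Z| is a function edge gamma -> R. *)
Notation edge gamma := {e : 'I__ * 'I__ | 0 < gamma e.1 e.2}.

Definition prob_vec (R : realType) (d : nat) : set ('I_d -> R) :=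
  [set m | (forall x, 0 <= m x) /\ \sum_x m x = 1].

(* [ln 0 = 0] in the library, hence [ell 0 = 1]. *)
Definition ell (R : realType) (q : R) : R := q * ln q - q + 1.

(* Extended-valued functions on [0, +oo[ are total functions R -> \bar R whose
   values at negative reals are never used.  In \bar R, 0 * +oo = 0. *)
Definition convex_nonneg (R : realType) (C : R -> \bar R) : Prop :=
  forall u v t : R, 0 <= u -> 0 <= v -> 0 <= t -> t <= 1 ->
    (C (t * u + (1 - t) * v)%R <= t%:E * C u + (1 - t)%R%:E * C v)%E.

Definition Lfun (R : realType) (g xi : R) (C : R -> \bar R) (u q : R)
    : \bar R :=
  ((q * xi + u * ell (q / u))%R%:E - g%:E * C (u / g)%R)%E.

Definition payoff (R : realType) (d : nat) (gamma : 'I_d -> 'I_d -> R)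
    (C : edge gamma -> R -> \bar R) (m : 'I_d -> R) (xi : edge gamma -> R)
    (u q : edge gamma -> R) : \bar R :=
  (\sum_(e : edge gamma)
     (m (val e).1)%:E *
     Lfun (gamma (val e).1 (val e).2) (xi e) (C e) (u e) (q e))%E.

Definition nonneg_vec (R : realType) (I : Type) : set (I -> R) :=
  [set q | forall i, 0 <= q i].

Definition pos_vec (R : realType) (I : Type) : set (I -> R) :=
  [set u | forall i, 0 < u i].

Definition infsup (R : realType) (A B : Type) (Q : set A) (U : set B)
    (F : B -> A -> \bar R) : \bar R :=
  ereal_inf [set ereal_sup [set F u q | u in U] | q in Q].

Definition supinf (R : realType) (A B : Type) (Q : set A) (U : set B)
    (F : B -> A -> \bar R) : \bar R :=
  ereal_sup [set ereal_inf [set F u q | q in Q] | u in U].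

(* The right end may be +oo. *)
Definition oitv (R : realType) (a : R) (b : \bar R) : set R :=
  [set u | a < u /\ (u%:E < b)%E].

(* On the set [D], which is meant to be open, the derivatives are those of the
   real-valued function [fine \o C]. *)
Definition finite_twice_derivable (R : realType) (D : set R)
    (C : R -> \bar R) : Prop :=
  forall u, D u ->
    [/\ C u \is a fin_num,
        derivable (fine \o C) u 1 &
        derivable (derive1 (fine \o C)) u 1].

(* Main.v *)
Require Import Defs.
From HB Require Import structures.
From mathcomp Require Import all_boot all_order all_algebra.
From mathcomp Require Import all_classical all_reals all_analysis.
From mathcomp Require Import ring lra.
Set Implicit Arguments.
Unset Strict Implicit.
Unset Printing Implicit Defensive.
Import Order.TTheory GRing.Theory Num.Theory.
Import numFieldNormedType.Exports.
Local Open Scope classical_set_scope.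
Local Open Scope ring_scope.

(* Take m to be the point mass at the tail of an edge, so that the minimax
   identity decouples over the outgoing edges; on the edges other than the
   given one, xi = 0 makes the value finite.  On the given edge (rates scaled
   to 1), if c = C'(w0) < 1 and xi = - ln (1 - c), then minimizing in q turns
   the payoff into c u - C u, which by convexity of C is largest at u = w0.  The
   minimax identity yields almost optimal q, which are forced to converge to
   q0 = w0 (1 - c).  Hence w0 maximizes u |-> u - C u - q0 ln u, that is,
   s |-> C (exp s) - exp s has the subgradient - q0 = w0 C'(w0) - w0 at ln w0,
   and subgradients of one function are monotone.  Where C' >= 1, the claim
   follows from the monotonicity of C' alone. *)

(** * Lower bounds for [ell] *)

(** For [r > 0] and [t = sqrt r], the right side minus the left side is [2 t^2 (ln t + 1/t - 1)],
    which is nonnegative because [ln (1/t) <= 1/t - 1]. *)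
Lemma sqr_sqrtB1_le_ell (R : realType) (r : R) :
  0 <= r -> (Num.sqrt r - 1) ^+ 2 <= ell r.
Proof.
rewrite /ell le_eqVlt => /predU1P[<-|r0].
  by rewrite sqrtr0 mul0r; lra.
have t0 : 0 < Num.sqrt r by rewrite sqrtr_gt0.
have := sqr_sqrtr (ltW r0); move: (Num.sqrt r) t0 => t t0 rE.
have tV0 : 0 < t^-1 by rewrite invr_gt0.
have ln_t : - ln t <= t^-1 - 1.
  rewrite -lnV ?posrE//.
  have -> : t^-1 = 1 + (t^-1 - 1) by lra.
  rewrite [X in _ <= X](_ : _ = t^-1 - 1); last by lra.
  by apply: le_ln1Dx; lra.
have tK : t * t^-1 = 1 by rewrite divff// gt_eqF.
rewrite -rE expr2 lnM ?posrE//.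
have : 0 <= t * t * (t^-1 - 1 + ln t) by rewrite !mulr_ge0 ?(ltW t0)//; lra.
have -> : t * t * (t^-1 - 1 + ln t) = t * (t * t^-1) - t * t + t * t * ln t.
  by ring.
by rewrite tK; nra.
Qed.

Lemma ell_ge0 (R : realType) (r : R) : 0 <= r -> 0 <= ell r.
Proof. by move=> /sqr_sqrtB1_le_ell; apply: le_trans; exact: sqr_ge0. Qed.

Lemma ell1 (R : realType) : ell 1 = 0 :> R.
Proof. by rewrite /ell ln1; lra. Qed.

(* The points r are almost minimizers of ell, whose minimum is attained only
   at 1, hence they tend to 1. *)
Lemma le0_of_almost_min_ell (R : realType) (a K D : R) : 0 < a ->
  (forall eps, 0 < eps -> exists2 r, 0 <= r &
     a * ell r <= eps /\ D + (r - 1) * K <= eps) -> D <= 0.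
Proof.
move=> a0 H; rewrite leNgt; apply/negP => D0.
have K0 := normr_ge0 K.
have S0 : 0 < D + a + 3 * `|K| by lra.
(* This choice gives [delta < 1] and [delta * (a + 3 |K|) < D]. With [eps := a * delta ^+ 2],
   [sqrt r] is within [delta] of 1, so [|r - 1| <= 3 * delta], and [D <= a * delta ^+ 2 + 3 * delta
   * |K| < D] is absurd. *)
pose delta := D / (D + a + 3 * `|K|).
have d0 : 0 < delta by rewrite divr_gt0.
have dS : delta * (D + a + 3 * `|K|) = D by rewrite divfK// gt_eqF.
have d1 : delta < 1 by rewrite ltr_pdivrMr//; lra.
have [|r r0 [ar DK]] := H (a * delta ^+ 2); first by rewrite mulr_gt0// exprn_gt0.
have : (Num.sqrt r - 1) ^+ 2 <= delta ^+ 2.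
  by apply: le_trans (sqr_sqrtB1_le_ell r0) _; rewrite -(ler_pM2l a0).
rewrite -(real_normK (num_real (_ - 1))) ler_sqr ?nnegrE// ?(ltW d0)// => td.
have t0 := sqrtr_ge0 r.
have rd : `|r - 1| <= 3 * delta.
  have -> : r - 1 = (Num.sqrt r - 1) * (Num.sqrt r + 1).
    by rewrite -{1}(sqr_sqrtr r0); ring.
  move: td; rewrite ler_norml => /andP[td1 td2].
  by rewrite ler_norml; apply/andP; split; nra.
have : - ((r - 1) * K) <= 3 * delta * `|K|.
  by rewrite (le_trans (ler_norm _))// normrN normrM ler_wpM2r.
nra.
Qed.

(* With r = w p the minimizer of the left-hand side for v = w, this isolates
   the distance of r to w p. *)
Lemma ell_perspectiveE (R : realType) (r p w v : R) :
  0 <= r -> 0 < p -> 0 < w -> 0 < v ->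
  r * - ln p + v * ell (r / v) =
  w * p * ell (r / (w * p)) - w * p + v + r * (ln w - ln v).
Proof.
move=> + p0 w0 v0; have wp0 := mulr_gt0 w0 p0.
rewrite /ell le_eqVlt => /predU1P[<-|r0]; first by rewrite !mul0r; ring.
rewrite !ln_div ?posrE// lnM ?posrE//.
field.
by apply/and3P; split; rewrite gt_eqF.
Qed.

(** * Tangents and subgradients *)

(** By convexity, the difference quotients of [C] at [w0] along [w - w0], with step in []0, 1]], are
    at most [C w - C w0]; their limit at [0+] is the derivative times [w - w0]. *)
Lemma convex_nonneg_tangent (R : realType) (C : R -> \bar R) (w0 w : R) :
  (forall u, 0 <= u -> (0 <= C u)%E) -> convex_nonneg C ->
  0 <= w0 -> 0 <= w -> C w0 \is a fin_num -> derivable (fine \o C) w0 1 ->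
  ((fine (C w0) + derive1 (fine \o C) w0 * (w - w0))%:E <= C w)%E.
Proof.
move=> C0 Cconv w00 w_0 Cw0 Cdrv.
have [->|Cw_oo] := eqVneq (C w) +oo%E; first by rewrite leey.
have Cw : C w \is a fin_num by rewrite ge0_fin_numE ?ltey ?C0.
rewrite -(fineK Cw) lee_fin.
have dif : differentiable (fine \o C) w0 by apply/derivable1_diffP.
set h := w - w0.
have -> : derive1 (fine \o C) w0 * h = 'D_h (fine \o C) w0.
  rewrite derive1E !deriveE// -[h in RHS]mulr1 -[h * 1]/(h *: 1) linearZ/=.
  by rewrite mulrC.
have cvD : derivable (fine \o C) w0 h by exact: diff_derivable.
rewrite -lerBrDl /derive cvg_at_rightE//.
apply: limr_le.
  by apply: cvgP; exact: cvg_dnbhs_at_right cvD.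
near=> t.
have t0 : 0 < t by near: t; exact: nbhs_right_gt.
have t1 : t <= 1 by near: t; exact: nbhs_right_le.
have z0 : 0 <= t * w + (1 - t) * w0 by apply: addr_ge0; apply: mulr_ge0 => //; lra.
have := Cconv w w0 t w_0 w00 (ltW t0) t1.
rewrite -(fineK Cw) -(fineK Cw0) -!EFinM -EFinD => Cz.
(* Finiteness matters here because [fine] maps [+oo] to 0. *)
have Czf : C (t * w + (1 - t) * w0) \is a fin_num.
  by rewrite ge0_fin_numE ?C0//; apply: le_lt_trans Cz _; rewrite ltry.
move: Cz; rewrite -(fineK Czf) lee_fin => Cz.
rewrite /= [X in X <= _]mulrC ler_pdivrMr//.
have -> : t *: h + w0 = t * w + (1 - t) * w0 by rewrite /h /GRing.scale/=; ring.
lra.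
Unshelve. all: by end_near.
Qed.

(* With q := - (w0 c - w0), the claim says that
   s |-> C (exp s) - exp s has the subgradient - q at ln w0. *)
Lemma log_subgradient (R : realType) (C : R -> \bar R) (c w0 v : R) :
  0 < w0 -> c < 1 -> 0 < v -> C w0 \is a fin_num -> C v \is a fin_num ->
  (forall eps, 0 < eps -> exists2 r, 0 <= r & forall w, 0 < w ->
     ((r * - ln (1 - c) + w * ell (r / w))%:E - C w <=
      (w0 * c - fine (C w0) + eps)%:E)%E) ->
  w0 * (1 - c) * (ln w0 - ln v) + v - w0 <= fine (C v) - fine (C w0).
Proof.
move=> w00 c1 v0 Cw0 Cv H.
have p0 : 0 < 1 - c by lra.
have a0 := mulr_gt0 w00 p0.
rewrite -subr_le0.
apply: (@le0_of_almost_min_ell _ (w0 * (1 - c)) (w0 * (1 - c) * (ln w0 - ln v))) => //.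
move=> eps eps0; have [r r0 Hr] := H _ eps0.
exists (r / (w0 * (1 - c))); first by rewrite divr_ge0// ltW.
have rE : r / (w0 * (1 - c)) * (w0 * (1 - c)) = r by rewrite divfK// gt_eqF.
have L0 : 0 <= w0 * (1 - c) * ell (r / (w0 * (1 - c))).
  by rewrite mulr_ge0 ?ell_ge0 ?divr_ge0// ltW.
(* The test point [w0] bounds the excess of [r] over the minimum by [eps]; the test point [v] gives
   the inequality linear in [r]. *)
split.
- move: (Hr _ w00); rewrite -{1}(fineK Cw0) -EFinB lee_fin.
  rewrite (@ell_perspectiveE _ r (1 - c) w0 w0)//; nra.
- move: (Hr _ v0); rewrite -{1}(fineK Cv) -EFinB lee_fin.
  rewrite (@ell_perspectiveE _ r (1 - c) w0 v)//.
  move: L0; set ls := ell _; set k := ln w0 - ln v => L0 Hv.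
  have -> : (r / (w0 * (1 - c)) - 1) * (w0 * (1 - c) * k) =
     r / (w0 * (1 - c)) * (w0 * (1 - c)) * k - w0 * (1 - c) * k by ring.
  rewrite rE; lra.
Qed.

(** * Isolating one edge in the minimax identity *)

(** The sup-inf is at most [A] plus the sum of the [s i], so some [q] keeps the whole sum below this
    bound plus [eps / 2] for all [u]. For that [q], the coordinates of [u] off [e] can be chosen to
    make their summands almost [s i]; cancelling these finite values leaves the bound at [e]. *)
Lemma minimax_decouple (R : realType) (I : finType) (T : I -> R -> R -> \bar R)
    (e : I) (s : I -> R) (A : R) :
  (forall u, 0 < u -> exists2 q, 0 <= q & (T e u q <= A%:E)%E) ->
  (forall i, i != e -> forall u, 0 < u ->
     exists2 q, 0 <= q & (T i u q <= (s i)%:E)%E) ->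
  (forall i, i != e -> forall eps, 0 < eps ->
     exists2 u, 0 < u & forall q, 0 <= q -> ((s i - eps)%:E <= T i u q)%E) ->
  (infsup (@nonneg_vec R I) (@pos_vec R I) (fun u q => \sum_i T i (u i) (q i)) <=
   supinf (@nonneg_vec R I) (@pos_vec R I) (fun u q => \sum_i T i (u i) (q i)))%E ->
  forall eps, 0 < eps -> exists2 q, 0 <= q &
    forall u, 0 < u -> (T e u q <= (A + eps)%:E)%E.
Proof.
move=> He Hs Hs' mm eps eps0.
pose S := \sum_(i | i != e) s i.
pose eps2 := eps / 2.
have eps20 : 0 < eps2 by rewrite divr_gt0.
have supinf_le : (supinf (@nonneg_vec R I) (@pos_vec R I)
    (fun u q => \sum_i T i (u i) (q i)) <= (A + S)%:E)%E.
  apply: ge_ereal_sup => _ [u u0 <-].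
  have /choice[q Hq] i : exists q, 0 <= q /\
      (T i (u i) q <= (if i == e then A else s i)%:E)%E.
    case: eqVneq => [->|ie]; first by have [q] := He _ (u0 e); exists q.
    by have [q] := Hs _ ie _ (u0 i); exists q.
  apply: ge_ereal_inf; exists (\sum_i T i (u i) (q i))%E.
    by exists q => // i; have [] := Hq i.
  rewrite (bigD1 e)//= EFinD /S -sumEFin; apply: leeD.
    by have [_] := Hq e; rewrite eqxx.
  by apply: lee_sum => i ie; have [_] := Hq i; rewrite (negbTE ie).
have [_ [q q0 <-] qlt] : exists2 y, [set ereal_sup [set (\sum_i T i (u i) (q i))%E
      | u in @pos_vec R I] | q in @nonneg_vec R I] y & (y < (A + S + eps2)%:E)%E.
  apply: ereal_inf_lt; apply: le_lt_trans mm _.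
  by apply: le_lt_trans supinf_le _; rewrite lte_fin ltrDl.
exists (q e) => [|u u0]; first exact: q0.
pose n := #|I|%:R + 1 : R.
have n0 : 0 < n by rewrite ltr_wpDl.
have /choice[w Hw] i : exists w, 0 < w /\
    (i != e -> (s i - eps2 / n)%:E <= T i w (q i))%E.
  have [->|ie] := eqVneq i e; first by exists 1.
  have [w w0 Hw] := Hs' _ ie _ (divr_gt0 eps20 n0).
  by exists w; split=> // _; apply: Hw; exact: q0.
pose u' i := if i == e then u else w i.
have : (T e u (q e) + (S - eps2)%:E <= (A + S + eps2)%:E)%E.
  apply: le_trans (ltW qlt).
  apply: le_ereal_sup_tmp; exists (\sum_i T i (u' i) (q i))%E.
    exists u' => // i; rewrite /u'; case: ifP => // _.
    by have [] := Hw i.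
  rewrite (bigD1 e)//= {1}/u' eqxx leeD2l//.
  apply: (@le_trans _ _ (\sum_(i | i != e) (s i - eps2 / n)%:E)%E).
    rewrite sumEFin lee_fin big_split/= lerD2l sumrN lerN2 sumr_const -mulr_natr.
    rewrite mulrAC ler_pdivrMr// ler_pM2l// /n.
    by rewrite (@le_trans _ _ #|I|%:R)// ?lerDl// ler_nat max_card.
  by apply: lee_sum => i ie; rewrite /u' (negbTE ie); have [_] := Hw i; exact.
rewrite -leeBrDr// -EFinB => /le_trans; apply.
by rewrite lee_fin /eps2; lra.
Qed.

Lemma exists_inf_pos (R : realType) (C : R -> \bar R) (w0 : R) :
  (forall u, 0 <= u -> (0 <= C u)%E) -> 0 < w0 -> C w0 \is a fin_num ->
  exists k : R, (forall w, 0 < w -> (k%:E <= C w)%E) /\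
    forall eps, 0 < eps -> exists2 w, 0 < w & (C w <= (k + eps)%:E)%E.
Proof.
move=> C0 w00 Cw0.
pose D := [set C w | w in [set w | 0 < w]].
have Dfin : ereal_inf D \is a fin_num.
  rewrite ge0_fin_numE.
    apply: le_lt_trans (_ : (C w0 < +oo)%E); last by rewrite ltey_eq Cw0.
    by apply: ereal_inf_lbound; exists w0.
  by apply: le_ereal_inf_tmp => _ [w w_0 <-]; apply: C0; exact: ltW.
exists (fine (ereal_inf D)); rewrite fineK//; split=> [w w_0|eps eps0].
  by apply: ereal_inf_lbound; exists w.
have [_ [w w_0 <-] Cw] := lb_ereal_inf_adherent eps0 Dfin.
by exists w => //; rewrite EFinD fineK// ltW.
Qed.

(** Since [ell] is nonnegative and vanishes at 1, [q = u] is optimal when [xi = 0]; hence [s] is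
    [- m * g] times the infimum of [C] over positive reals. *)
Lemma Lfun0_inf_sup (R : realType) (m g : R) (C : R -> \bar R) (w0 : R) :
  0 <= m -> 0 < g ->
  (forall u, 0 <= u -> (0 <= C u)%E) -> 0 < w0 -> C w0 \is a fin_num ->
  exists s : R,
    (forall u, 0 < u -> exists2 q, 0 <= q & (m%:E * Defs.Lfun g 0 C u q <= s%:E)%E) /\
    (forall eps, 0 < eps -> exists2 u, 0 < u &
       forall q, 0 <= q -> ((s - eps)%:E <= m%:E * Defs.Lfun g 0 C u q)%E).
Proof.
move=> m0 g0 C0 w00 Cw0; have [k [kle kge]] := exists_inf_pos C0 w00 Cw0.
exists (- (m * (g * k))); split=> [u u0|eps eps0].
  exists u; first exact: ltW.
  rewrite /Defs.Lfun mulr0 add0r divff ?gt_eqF// ell1 mulr0 sub0e.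
  rewrite muleN EFinN leeN2 !EFinM.
  apply: lee_wpmul2l; first by rewrite lee_fin.
  apply: lee_wpmul2l; first by rewrite lee_fin ltW.
  by apply: kle; rewrite divr_gt0.
(* The added 1 keeps the divisor positive when [m = 0]. *)
have mg0 : 0 < m * g + 1 by rewrite ltr_wpDl// mulr_ge0// ltW.
have [w w_0 Cw] := kge _ (divr_gt0 eps0 mg0).
have Cwf : C w \is a fin_num.
  by rewrite ge0_fin_numE ?C0 ?ltW// (le_lt_trans Cw)// ltry.
exists (g * w) => [|q q0]; first by rewrite mulr_gt0.
rewrite /Defs.Lfun mulr0 add0r [g * w / g]mulrAC divff ?gt_eqF// mul1r.
move: Cw; rewrite -(fineK Cwf) -EFinM !lee_fin => Cw.
have L0 : 0 <= m * (g * w * ell (q / (g * w))).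
  by rewrite !mulr_ge0 ?ell_ge0 ?divr_ge0 ?mulr_ge0// ltW.
have : m * g * fine (C w) <= m * g * (k + eps / (m * g + 1)).
  by rewrite ler_wpM2l// mulr_ge0// ltW.
have epsE : eps / (m * g + 1) * (m * g + 1) = eps by rewrite divfK// gt_eqF.
have := divr_gt0 eps0 mg0; nra.
Qed.

(** For [xi = - ln (1 - c)], the terms in [q] are minimal at [q = u * (1 - c)], with value [u * c];
    the tangent to [C] at [w0] cancels the dependence on [u]. *)
Lemma Lfun_min_le (R : realType) (g c : R) (C : R -> \bar R) (w0 u : R) :
  (forall w, 0 <= w -> ((fine (C w0) + c * (w - w0))%:E <= C w)%E) ->
  0 < g -> c < 1 -> 0 < u ->
  (Defs.Lfun g (- ln (1 - c)) C u (u * (1 - c)) <=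
   (g * (w0 * c - fine (C w0)))%:E)%E.
Proof.
move=> tangent g0 c1 u0.
have p0 : 0 < 1 - c by lra.
have up0 := mulr_gt0 u0 p0.
rewrite /Defs.Lfun (@ell_perspectiveE _ _ _ u)// ?(ltW up0)//.
rewrite divff ?gt_eqF// ell1 subrr !mulr0 addr0 sub0r.
have ug0 : 0 <= u / g by rewrite divr_ge0// ltW.
have : (g%:E * (fine (C w0) + c * (u / g - w0))%:E <= g%:E * C (u / g)%R)%E.
  by rewrite lee_wpmul2l ?tangent// lee_fin ltW.
rewrite -leeN2 => /(leeD2l (- (u * (1 - c)) + u)%:E) /le_trans; apply.
have ugE : u / g * g = u by rewrite divfK// gt_eqF.
by rewrite -EFinM -EFinN -EFinD lee_fin; nra.
Qed.

(** Homogeneity of [u * ell (q / u)] in [(u, q)] reduces the rate to 1. *)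
Lemma Lfun_rescale (R : realType) (g xi M w q : R) (C : R -> \bar R) :
  0 < g -> (0 <= C w)%E ->
  (Defs.Lfun g xi C (g * w) q <= (g * M)%:E)%E ->
  ((q / g * xi + w * ell (q / g / w))%:E - C w <= M%:E)%E.
Proof.
move=> g0; rewrite /Defs.Lfun [g * w / g]mulrAC divff ?gt_eqF// mul1r.
have [->|Coo C0] := eqVneq (C w) +oo%E; first by rewrite /= leNye.
have Cf : C w \is a fin_num by rewrite ge0_fin_numE ?ltey.
rewrite -(fineK Cf) -EFinM -!EFinB !lee_fin invfM mulrA.
rewrite -(ler_pM2l g0 _ M).
apply: le_trans; rewrite le_eqVlt; apply/orP; left; apply/eqP.
rewrite mulrBr mulrDr !mulrA.
by rewrite (mulrC g q) mulfK ?gt_eqF//.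
Qed.

Theorem theorem3p3 (R : realType) (d : nat) (hd : (0 < d)%N)
    (gamma : 'I_d -> 'I_d -> R) (hgamma : ergodic_rates gamma)
    (C : edge gamma -> R -> \bar R)
    (hC0 : forall (e : edge gamma) (u : R), 0 <= u -> (0 <= C e u)%E)
    (hCconvex : forall e : edge gamma, convex_nonneg (C e))
    (hminimax : forall (m : 'I_d -> R) (xi : edge gamma -> R),
        prob_vec m ->
        infsup (@nonneg_vec R (edge gamma)) (@pos_vec R (edge gamma))
               (payoff C m xi) =
        supinf (@nonneg_vec R (edge gamma)) (@pos_vec R (edge gamma))
               (payoff C m xi))
    (u1 : edge gamma -> R) (u2 : edge gamma -> \bar R)
    (hu1 : forall e : edge gamma, 0 <= u1 e)
    (hu12 : forall e : edge gamma, ((u1 e)%:E < u2 e)%E)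
    (hCdiff : forall e : edge gamma,
        finite_twice_derivable (oitv (u1 e) (u2 e)) (C e)) :
  forall (e : edge gamma) (u v : R),
    oitv (u1 e) (u2 e) u -> oitv (u1 e) (u2 e) v -> u <= v ->
    u * derive1 (fine \o C e) u - u <= v * derive1 (fine \o C e) v - v.
Proof.
move=> e u v Iu Iv.
have pos i w : oitv (u1 i) (u2 i) w -> 0 < w.
  by move=> [/(le_lt_trans (hu1 i))].
have tangent w0 w : oitv (u1 e) (u2 e) w0 -> 0 <= w ->
    ((fine (C e w0) + derive1 (fine \o C e) w0 * (w - w0))%:E <= C e w)%E.
  move=> Iw0 w_0; have [Cw0 dC _] := hCdiff _ _ Iw0.
  by apply: convex_nonneg_tangent => //; [exact: hC0|exact/ltW/(pos e)].
have subgrad w0 w : oitv (u1 e) (u2 e) w0 -> oitv (u1 e) (u2 e) w ->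
    derive1 (fine \o C e) w0 < 1 ->
    w0 * (1 - derive1 (fine \o C e) w0) * (ln w0 - ln w) + w - w0 <=
    fine (C e w) - fine (C e w0).
  move=> Iw0 Iw; have := tangent w0 ^~ Iw0.
  move: (derive1 _ w0) => c c_tangent c1.
  have w00 := pos _ _ Iw0.
  have [Cw0 _ _] := hCdiff _ _ Iw0; have [Cw _ _] := hCdiff _ _ Iw.
  apply: log_subgradient => //; first exact: pos Iw.
  pose g (i : edge gamma) := gamma (val i).1 (val i).2.
  have g0 i : 0 < g i := valP i.
  pose m y : R := (y == (val e).1)%:R.
  have m0 y : 0 <= m y by exact: ler0n.
  have m_prob : prob_vec m.
    split=> //; rewrite (bigD1 (val e).1)//= /m eqxx big1 ?addr0// => y.
    by move/negbTE => ->.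
  pose xi i : R := if i == e then - ln (1 - c) else 0.
  have /choice[s Hs] i : exists s : R,
      (forall u, 0 < u -> exists2 q, 0 <= q &
         ((m (val i).1)%:E * Defs.Lfun (g i) 0 (C i) u q <= s%:E)%E) /\
      (forall eps, 0 < eps -> exists2 u, 0 < u & forall q, 0 <= q ->
         ((s - eps)%:E <= (m (val i).1)%:E * Defs.Lfun (g i) 0 (C i) u q)%E).
    (* A point where [C i] is finite makes its infimum finite. *)
    have [z Iz] : exists z, oitv (u1 i) (u2 i) z.
      have := hu12 i; case: (u2 i) => [b| |]//.
      - rewrite lte_fin => ub; exists ((u1 i + b) / 2).
        by split; rewrite ?lte_fin ?midf_lt.
      - by exists (u1 i + 1); split; rewrite ?ltry ?ltrDl.
    have [Cz _ _] := hCdiff _ _ Iz.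
    by apply: (Lfun0_inf_sup _ _ _ (pos _ _ Iz) Cz) => //; exact: hC0.
  pose T i a q := ((m (val i).1)%:E * Defs.Lfun (g i) (xi i) (C i) a q)%E.
  have Te a q : T e a q = Defs.Lfun (g e) (- ln (1 - c)) (C e) a q.
    by rewrite /T /m /xi !eqxx mul1e.
  have := @minimax_decouple R (edge gamma) T e s (g e * (w0 * c - fine (C e w0))).
  move=> decouple eps eps0.
  have [|i ie|i ie| | |q q0 Hq] := decouple _ _ _ _ (g e * eps).
  - move=> a a0; exists (a * (1 - c)); last by rewrite Te Lfun_min_le.
    by rewrite mulr_ge0 ?ltW// subr_gt0.
  - by rewrite /T /xi (negbTE ie); have [] := Hs i.
  - by rewrite /T /xi (negbTE ie); have [] := Hs i.
  - by rewrite le_eqVlt -/(payoff C m xi) (hminimax _ _ m_prob) eqxx.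
  - exact: mulr_gt0.
  exists (q / g e); first by rewrite divr_ge0// ltW.
  move=> z z0; apply: (Lfun_rescale (g0 e)); first exact/hC0/ltW.
  by rewrite -Te mulrDr; apply: Hq; rewrite mulr_gt0.
have u0 := pos _ _ Iu; have v0 := pos _ _ Iv.
rewrite le_eqVlt => /predU1P[->//|uv].
have [Cu _ _] := hCdiff _ _ Iu; have [Cv _ _] := hCdiff _ _ Iv.
have := tangent _ _ Iu (ltW v0); rewrite -(fineK Cv) lee_fin => tu.
have := tangent _ _ Iv (ltW u0); rewrite -(fineK Cu) lee_fin => tv.
move: (subgrad _ _ Iu Iv) (subgrad _ _ Iv Iu) tu tv.
rewrite /=; set a := derive1 _ u; set b := derive1 _ v => su sv tu tv.
(* The two tangents give [a * (v - u) <= C v - C u <= b * (v - u)]. *)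
have ab : a <= b by rewrite -(@ler_pM2r _ (v - u)) ?subr_gt0//; lra.
have [b1|b1] := ltP b 1; last first.
  have [a1|a1] := ltP a 1; nra.
(* Adding both subgradient inequalities yields [(v * (1 - b) - u * (1 - a)) * (ln v - ln u) <=
   0]. *)
have := su (le_lt_trans ab b1); have := sv b1.
have : ln u < ln v by rewrite ltr_ln.
nra.
Qed.
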